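(* Let $a,b>0$ be real numbers. Then for every integer $l\ge 0$, $$(a+b)_l=\sum_{i=0}^{l}\frac{1}{i!}\left[\frac{d^{\,i}}{da^i}(a)_l\right]b^i ,$$ where $\frac{d^{\,i}}{da^i}(a)_l$ denotes the $i$-th derivative of the function $a\mapsto (a)_l$ evaluated at $a$ (the case $i=0$ being $(a)_l$ itself).
   Context: For $a>0$ and an integer $l\ge 0$, $(a)_l=\Gamma(a+l)/\Gamma(a)$ denotes the ascending factorial (Pochhammer symbol): $(a)_0=1$ and $(a)_l=a(a+1)\cdots(a+l-1)$ for $l\ge 1$. *)

(* Defs.v *)
From Stdlib Require Import Reals Lra Lia.
From Coquelicot Require Import Coquelicot.
Open Scope R_scope.

(* Ascending factorial: pochhammer a l = a (a+1) ... (a+l-1). *)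
Fixpoint pochhammer (a : R) (l : nat) : R :=
  match l with
  | O => 1
  | S k => pochhammer a k * (a + INR k)
  end.

(* Any function positive on (0, +oo) with the functional equation of Gamma
   gives the Gamma quotient form of the ascending factorial. *)
Lemma pochhammer_Gamma_quotient (G : R -> R)
    (G_pos : forall x, 0 < x -> 0 < G x)
    (G_rec : forall x, 0 < x -> G (x + 1) = x * G x)
    (a : R) (l : nat) :
  0 < a -> pochhammer a l = G (a + INR l) / G a.
Proof.
intros Ha.
assert (HG : G a <> 0) by (apply Rgt_not_eq, G_pos, Ha).
induction l as [|l IH].
- simpl; rewrite Rplus_0_r; field; exact HG.
- simpl pochhammer; rewrite IH, S_INR, <- Rplus_assoc, G_rec.
  + field; exact HG.
  + pose proof (pos_INR l); lra.
Qed.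

Lemma Derive_n_mult_affine (f : R -> R) (c : R)
    (f_smooth : forall n x, ex_derive (Derive_n f n) x) (n : nat) (x : R) :
  Derive_n (fun y => f y * (y + c)) n x =
  Derive_n f n x * (x + c) + INR n * Derive_n f (pred n) x.
Proof.
revert x; induction n as [|n IH]; intros x.
- simpl; ring.
- change (Derive (Derive_n (fun y => f y * (y + c)) n) x =
    Derive (Derive_n f n) x * (x + c) + INR (S n) * Derive_n f n x).
  rewrite (Derive_ext _ _ _ IH); apply is_derive_unique.
  pose proof (Derive_correct _ _ (f_smooth n x)) as Hn.
  destruct n as [|n].
  + apply (is_derive_ext (fun y => Derive_n f 0 y * (y + c))).
    * intros t; simpl; ring.
    * evar_last.
      -- apply (is_derive_mult _ (fun y => y + c) x _ 1 Hn); [|exact Rmult_comm].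
         auto_derive; [exact I|ring].
      -- unfold plus, mult; simpl; ring.
  + pose proof (Derive_correct _ _ (f_smooth n x)) as Hp.
    evar_last.
    * apply (is_derive_plus (fun y => Derive_n f (S n) y * (y + c))
               (fun y => INR (S n) * Derive_n f n y) x).
      -- apply (is_derive_mult _ (fun y => y + c) x _ 1 Hn); [|exact Rmult_comm].
         auto_derive; [exact I|ring].
      -- apply is_derive_scal; exact Hp.
    * rewrite (S_INR (S n)); unfold plus, mult; simpl; ring.
Qed.

(* Coquelicot's Derive is total, so existence is recorded separately: the
   iterated derivatives of the ascending factorial are genuine derivatives. *)
Lemma ex_derive_n_pochhammer (l i : nat) (a : R) :
  ex_derive_n (fun x => pochhammer x l) i a.
Proof.
assert (H : forall n x, ex_derive (Derive_n (fun y => pochhammer y l) n) x).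
{ induction l as [|l IH]; intros n x.
  - apply (ex_derive_ext (fun _ => match n with O => 1 | S _ => 0 end)).
    + intros t; simpl; destruct n; [reflexivity|now rewrite Derive_n_const].
    + apply ex_derive_const.
  - apply (ex_derive_ext (fun y =>
      Derive_n (fun z => pochhammer z l) n y * (y + INR l) +
      INR n * Derive_n (fun z => pochhammer z l) (pred n) y)).
    + intros t; symmetry; exact (Derive_n_mult_affine _ _ IH n t).
    + auto_derive; repeat split; apply IH. }
destruct i as [|i]; [exact I|exact (H i a)].
Qed.

(* Main.v *)
Require Import Defs.
From Stdlib Require Import Reals Factorial Lia Lra.
From Coquelicot Require Import Coquelicot.
Open Scope R_scope.

(** As a function of [a], the ascending factorial [pochhammer a l] is a polynomial
    of degree [l], so its derivatives of order above [l] vanish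
    ([Derive_n_pochhammer_eq_0]). The identity is therefore its Taylor expansion
    at [a], evaluated at [a + b]: in the Taylor-Lagrange formula of order [l] on
    the interval from [a] to [a + b], the remainder involves the derivative of
    order [l + 1] at an intermediate point, which is zero. *)

(** By induction on [l]: multiplying by the affine factor [a + l] raises by one
    the order from which derivatives vanish, because Leibniz' rule expresses the
    [n]-th derivative of the product through those of orders [n] and [n - 1]. *)
Lemma Derive_n_pochhammer_eq_0 (l n : nat) (x : R) :
  (l < n)%nat -> Derive_n (fun y => pochhammer y l) n x = 0.
Proof.
revert n x; induction l as [|l IH]; intros n x Hn.
- destruct n as [|n]; [lia|].
  exact (Derive_n_const n 1 x).
- change (Derive_n (fun y => pochhammer y l * (y + INR l)) n x = 0).
  rewrite (Derive_n_mult_affine (fun y => pochhammer y l)).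
  + rewrite !IH by lia; ring.
  + intros k t; exact (ex_derive_n_pochhammer l (S k) t).
Qed.

Theorem proposition3p1 (a b : R) (ha : 0 < a) (hb : 0 < b) (l : nat) :
  pochhammer (a + b) l =
  sum_f_R0
    (fun i : nat =>
       1 / INR (fact i) * Derive_n (fun x : R => pochhammer x l) i a * b ^ i)
    l.
Proof.
destruct (Taylor_Lagrange (fun x => pochhammer x l) l a (a + b))
  as [zeta [_ Htaylor]].
- lra.
- intros t _ k _; apply ex_derive_n_pochhammer.
- rewrite Htaylor, Derive_n_pochhammer_eq_0 by lia.
  rewrite Rmult_0_r, Rplus_0_r.
  apply sum_eq; intros i _.
  replace (a + b - a) with b by ring.
  field; apply INR_fact_neq_0.
Qed.
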